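(* Let $\pi\in\mathcal P_2(\mathbb R^d)$, let $K$ be a positive integer and let $\mathbf p=(p_1,\dots,p_K)$ satisfy $p_k>0$ and $\sum_{k=1}^Kp_k=1$. Suppose the distribution loss function $L$ is either the Elo loss (in which case $d=1$ and $\pi$ is supported on $(0,\infty)$) or the variance loss. Let $\mu_1,\dots,\mu_K$ be probability densities forming an optimal solution of the optimal decomposition problem with specified weights $\mathbf p$ and loss $L$, and let $S_k(\delta,c)$ be the $(\delta,c)$-interior support of $\mu_k$. Then $S_i(\delta,c)\cap S_j(\delta,c)=\emptyset$ for any $\delta,c>0$ and any $i,j\in[K]$ with $i\neq j$.
   Context: $[K]=\{1,\dots,K\}$. $\mathcal P_2(\mathbb R^d)$ is the set of Borel probability measures on $\mathbb R^d$ with finite second moment; $\mathcal P_{2,ac}(\mathbb R^d)$ is the subset of those absolutely continuous with respect to Lebesgue measure; a measure and its density are denoted by the same symbol. Elo loss (skill levels in $(0,\infty)$): $L(\mu)=\int\int\left(\frac{x}{x+y}-\frac12\right)^2d\mu(x)\,d\mu(y)=\frac12\int\int\frac{x^2+y^2}{(x+y)^2}\,d\mu(x)\,d\mu(y)-\frac14$. Variance loss: $L(\mu)=\int_{\mathbb R^d}\langle\mathbf x-\mathbb E_\mu[X],W(\mathbf x-\mathbb E_\mu[X])\rangle\,d\mu(\mathbf x)$, where $W$ is a $d\times d$ diagonal matrix with nonzero diagonal entries and $\mathbb E_\mu[X]$ is the mean of $\mu$. Optimal decomposition problem with specified weights: given $\pi$, $K$, $\mathbf p$ and $L$, minimize $F_{\mathbf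 p}(\boldsymbol\mu)=\sum_{k\in[K]}p_kL(\mu_k)$ over $\boldsymbol\mu=(\mu_1,\dots,\mu_K)\in\mathcal P_2(\mathbb R^d)^{K}$ such that $\sum_{k\in[K]}p_k\mu_k=\pi$ (equality of measures). $(\delta,c)$-interior support: for $\delta,c>0$, the $(\delta,c)$-interior support of a density $\mu\in\mathcal P_{2,ac}(\mathbb R^d)$ is the set of all $\mathbf x\in\mathbb R^d$ such that $\mu(\mathbf y)>c$ for all $\mathbf y\in\mathbb R^d$ with $\|\mathbf x-\mathbf y\|\le\delta$.
   Formalization: For the variance loss, the matrix W is additionally assumed to have at least one positive diagonal entry; if all entries are negative the claim is false (for Gaussian π and K ≥ 2, taking every μ_k = π is optimal). *)

(* Defs.v *)
From HB Require Import structures.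
From mathcomp Require Import all_boot all_order all_algebra.
From mathcomp Require Import all_classical all_reals all_analysis.

Set Implicit Arguments.
Unset Strict Implicit.
Unset Printing Implicit Defensive.

Import Order.TTheory GRing.Theory Num.Theory.
Import numFieldNormedType.Exports.

Local Open Scope classical_set_scope.
Local Open Scope ring_scope.

(* Points of R^d are d.-tuple R. The sigma-algebra that MathComp-Analysis puts
   on d.-tuple R is generated by the coordinate projections, that is, it is the
   Borel sigma-algebra of R^d. *)

Definition cons_pair (R : realType) (n : nat) (p : (n.-tuple R * R)%type) :
    n.+1.-tuple R :=
  [tuple of p.2 :: p.1].

Lemma measurable_cons_pair (R : realType) (n : nat) :
  measurable_fun [set: (n.-tuple R * R)%type] (@cons_pair R n).
Proof. exact: (measurable_cons measurable_snd measurable_fst). Qed.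

Definition lebesgue_product (R : realType) (n : nat)
    (m : {measure set (n.-tuple R) -> \bar R}) :
    set (n.+1.-tuple R) -> \bar R :=
  pushforward (m \x lebesgue_measure)%E (@cons_pair R n).

Section lebesgue_product_measure.
Variables (R : realType) (n : nat) (m : {measure set (n.-tuple R) -> \bar R}).

Let mf := @measurable_cons_pair R n.

Let lp0 : lebesgue_product m set0 = 0%E.
Proof. by rewrite /lebesgue_product /pushforward preimage_set0 measure0. Qed.

Let lp_ge0 A : (0 <= lebesgue_product m A)%E.
Proof. exact: measure_ge0. Qed.

Let lp_sigma_additive : semi_sigma_additive (lebesgue_product m).
Proof.
have -> : lebesgue_product m = pushforward (m \x lebesgue_measure)%E
  (@cons_pair R n) by [].
exact: measure_semi_sigma_additive.
Qed.

HB.instance Definition _ := isMeasure.Build _ _ _ (lebesgue_product m)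
  lp0 lp_ge0 lp_sigma_additive.

End lebesgue_product_measure.

(* Lebesgue measure on R^n, as an iterated product starting from the Dirac mass
   on the one-point space R^0. *)
Fixpoint lebesgue_tuple (R : realType) (n : nat) :
    {measure set (n.-tuple R) -> \bar R} :=
  match n with
  | 0%N => \d_ ([tuple] : 0.-tuple R)
  | m.+1 => lebesgue_product (lebesgue_tuple R m)
  end.

Lemma lebesgue_tuple_box (R : realType) (n : nat) (A : 'I_n -> set R) :
  (forall i, measurable (A i)) ->
  lebesgue_tuple R n [set x | forall i, A i (tnth x i)] =
  (\prod_(i < n) lebesgue_measure (A i))%E.
Proof.
elim: n A => [|n IHn] A mA.
  rewrite big_ord0 /= diracE mem_set//; by case.
rewrite big_ord_recl -IHn; last by move=> i; exact: mA.
rewrite /= /lebesgue_product /pushforward.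
pose B : set (n.-tuple R) := [set x | forall i, A (lift ord0 i) (tnth x i)].
have mB : measurable B.
  rewrite (_ : B = \bigcap_(i in [set: 'I_n])
      ((fun x : n.-tuple R => tnth x i) @^-1` A (lift ord0 i))).
    apply: fin_bigcap_measurable => // i _.
    rewrite -[X in measurable X]setTI.
    exact: (measurable_tnth i).
  by apply/seteqP; split=> x /= Bx i; [move=> _; exact: Bx|exact: Bx].
rewrite [X in (_ \x _)%E X](_ : _ = B `*` A ord0).
  by rewrite product_measure1E; [rewrite muleC|exact: mB|exact: mA].
apply/seteqP; split=> -[t x] /=.
  by move=> h; split=> [i|]; [have := h (lift ord0 i); rewrite tnthS|
    have := h ord0; rewrite tnth0].
by move=> [hB h0] i; case: (unliftP ord0 i) => [j|] ->; rewrite ?tnthS ?tnth0.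
Qed.

Section losses_and_decompositions.
Variables (R : realType) (d : nat).

Notation point := (d.-tuple R).
Implicit Types (x y : point) (mu : probability point R).

Definition tuple_rV x : 'rV[R]_d := \row_i tnth x i.

Definition euclidean_norm (v : 'rV[R]_d) : R := Num.sqrt (\sum_i v 0 i ^+ 2).

Definition finite_second_moment mu : Prop :=
  (\int[mu]_x (euclidean_norm (tuple_rV x) ^+ 2)%:E < +oo)%E.

Definition is_density mu (f : point -> R) : Prop :=
  [/\ measurable_fun [set: point] f,
      forall x, 0 <= f x &
      forall A : set point, measurable A ->
        mu A = (\int[lebesgue_tuple R d]_(x in A) (f x)%:E)%E].

Definition interior_support (f : point -> R) (delta c : R) : set point :=
  [set x | forall y, euclidean_norm (tuple_rV x - tuple_rV y) <= delta ->
                     c < f y].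

(* Only used when d = 1, where head 0 x is the unique coordinate of x. *)
Definition skills : set point := [set x | 0 < head 0 x].

Definition elo_loss mu : R :=
  \int[mu]_(x in skills) \int[mu]_(y in skills)
    (head 0 x / (head 0 x + head 0 y) - 2^-1) ^+ 2.

Definition mean mu : 'rV[R]_d := \row_i fine ('E_mu[fun x => tnth x i])%E.

(* For a row vector v, v *m W *m v^T is the 1 x 1 matrix <v, W v>. *)
Definition variance_loss (W : 'M[R]_d) mu : R :=
  \int[mu]_x (let v := tuple_rV x - mean mu in (v *m W *m v^T) 0 0).

Variable K : nat.
Implicit Types (p : 'I_K -> R) (pi : probability point R)
  (mus nus : 'I_K -> probability point R).

Definition feasible pi p mus : Prop :=
  (forall k, finite_second_moment (mus k)) /\
  (forall A : set point, measurable A ->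
     (\sum_(k < K) (p k)%:E * mus k A)%E = pi A).

Definition objective (L : probability point R -> R) p mus : R :=
  \sum_(k < K) p k * L (mus k).

Definition optimal_decomposition (L : probability point R -> R) pi p mus :
    Prop :=
  feasible pi p mus /\
  (forall nus, feasible pi p nus -> objective L p mus <= objective L p nus).

End losses_and_decompositions.

Arguments skills {R d}.

(* Main.v *)
Require Import Defs.
From HB Require Import structures.
From mathcomp Require Import all_boot all_order all_algebra.
From mathcomp Require Import all_classical all_reals all_analysis.
From mathcomp Require Import measurable_realfun ring lra.

Set Implicit Arguments.
Unset Strict Implicit.
Unset Printing Implicit Defensive.

Import Order.TTheory GRing.Theory Num.Theory.
Import numFieldNormedType.Exports.

Local Open Scope classical_set_scope.
Local Open Scope ring_scope.

(** Both losses are strictly concave along suitable perturbations, so an optimal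
    decomposition leaves no room for a local exchange of mass between two of
    its components.

    Suppose that [x0] lies in the interior supports of [f i] and [f j].  Take
    two disjoint translates [P] and [N] of a small cube, on opposite sides of
    [x0] in some direction [a] and inside the ball on which both densities
    exceed [c].  With [h] the difference of the Lebesgue measures restricted to
    [P] and to [N], the total mass of [h] is zero, so for small [t > 0] the
    measures [mu i + t * p j * h] and [mu i - t * p j * h] are probabilities,
    and likewise [mu j - t * p i * h] and [mu j + t * p i * h]
    ([exists_box_shift]).  Changing the two components simultaneously, with
    opposite signs, keeps the mixture [\sum_k p k * mu k] equal to [pi]
    ([feasible_exchange]).

    The two opposite exchanges have [mu] as their midpoint.  If the loss
    satisfies [L (m + t h) + L (m - t h) < 2 L m], adding up the two objectives
    shows that one of the exchanges beats [mu]
    ([optimal_no_concave_exchange]).  First-order terms cancel in such a second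
    difference, and what remains is a quadratic form in [h].

    - For the variance loss, the form is
      [- \sum_b W b b * (\int x_b dh)^2].  Diagonal entries may be negative, but
      [P] and [N] differ only in direction [a], so [\int x_b dh = 0] for
      [b != a]; choosing [a] with [W a a > 0] makes the form negative
      ([variance_strictly_concave], [box_measure_mean_off],
      [box_measure_mean_on]).
    - For the Elo loss, the form is the double integral of
      [((x - y) / (2 (x + y)))^2] against [h x h].  Here [x0 > 0], and on a
      small neighbourhood of [x0] the denominator is nearly constant.  The gap
      between [P] and [N] is twice their diameter, so the kernel is larger on
      [P x N] than on [P x P] and [N x N], and the form is negative
      ([energy_strictly_concave], [elo_loss_strictly_concave]). *)

(** * Integration against a measure concentrated on a set *)

Section concentrated.
Context dsp (T : measurableType dsp) (R : realType).
Variables (sg : {finite_measure set T -> \bar R}) (P : set T).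
Hypotheses (mP : measurable P) (sgP : sg (~` P) = 0%E).

Lemma concentrated_integrable (g : T -> R) (C : R) :
  measurable_fun setT g -> (forall x, P x -> `|g x| <= C) ->
  sg.-integrable setT (EFin \o g).
Proof.
move=> mg gC.
have mPC : measurable (~` P) by exact: measurableC.
apply/(negligible_integrable mPC measurableT _ sgP).
  exact/measurable_EFinP.
rewrite setTD setCK; apply: measurable_bounded_integrable => //.
- by rewrite -ge0_fin_numE// fin_num_measure.
- exact: measurable_funTS.
- exists C; split; first exact: num_real.
  by move=> M CM x Px; exact: (le_trans (gC _ Px) (ltW CM)).
Qed.

Lemma concentrated_Rintegral (g : T -> R) :
  sg.-integrable setT (EFin \o g) ->
  \int[sg]_x g x = \int[sg]_(x in P) g x.
Proof.
move=> ig; rewrite /Rintegral.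
rewrite (negligible_integral (measurableC mP) measurableT ig sgP).
by rewrite setTD setCK.
Qed.

Lemma concentrated_mass : sg P = sg setT.
Proof.
have := measureU sg (measurableC mP) mP (setICl P).
by rewrite setvU => ->; rewrite [X in (X + _)%E]sgP add0e.
Qed.

Lemma concentrated_le (g : T -> R) (m : R) :
  sg.-integrable setT (EFin \o g) -> (forall x, P x -> g x <= m) ->
  \int[sg]_x g x <= m * fine (sg setT).
Proof.
move=> ig gm; rewrite concentrated_Rintegral// -concentrated_mass.
rewrite -Rintegral_cst//; apply: le_Rintegral => //.
- exact: integrableS ig.
- exact: finite_measure_integrable_cst.
Qed.

Lemma concentrated_ge (g : T -> R) (m : R) :
  sg.-integrable setT (EFin \o g) -> (forall x, P x -> m <= g x) ->
  m * fine (sg setT) <= \int[sg]_x g x.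
Proof.
move=> ig gm; rewrite concentrated_Rintegral// -concentrated_mass.
rewrite -Rintegral_cst//; apply: le_Rintegral => //.
- exact: finite_measure_integrable_cst.
- exact: integrableS ig.
Qed.

End concentrated.

(** * Perturbing a measure by a difference of two measures *)

Section exchange.
Context dsp (T : measurableType dsp) (R : realType).
Implicit Types mu nu sg tau : {finite_measure set T -> \bar R}.

(** The identity [nu = mu + sg - tau], written without subtraction so that it
    makes sense for extended-real-valued measures and passes to integrals by
    additivity. *)
Definition shifted mu sg tau nu := forall A, measurable A ->
  (nu A + tau A = mu A + sg A)%E.

Lemma shifted_integral_ge0 mu sg tau nu (g : T -> \bar R) :
  shifted mu sg tau nu -> measurable_fun setT g -> (forall x, 0 <= g x)%E ->
  (\int[nu]_x g x + \int[tau]_x g x = \int[mu]_x g x + \int[sg]_x g x)%E.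
Proof.
move=> sh mg g0.
rewrite -!ge0_integral_measure_add//.
apply: eq_measure_integral => A mA _.
by rewrite [LHS]measure_addE [RHS]measure_addE; exact: sh.
Qed.

Lemma shifted_integrable mu sg tau nu (g : T -> R) :
  shifted mu sg tau nu -> mu.-integrable setT (EFin \o g) ->
  sg.-integrable setT (EFin \o g) -> nu.-integrable setT (EFin \o g).
Proof.
move=> sh /integrableP[mg img] /integrableP[_ isg].
apply/integrableP; split => //.
apply: (@le_lt_trans _ _ (\int[mu]_x `|(EFin \o g) x| +
                          \int[sg]_x `|(EFin \o g) x|)%E); last first.
  by rewrite lte_add_pinfty.
rewrite -(shifted_integral_ge0 sh)//; last exact: measurableT_comp.
by rewrite leeDl// integral_ge0.
Qed.

Lemma shifted_Rintegral mu sg tau nu (g : T -> R) :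
  shifted mu sg tau nu -> mu.-integrable setT (EFin \o g) ->
  sg.-integrable setT (EFin \o g) -> tau.-integrable setT (EFin \o g) ->
  \int[nu]_x g x = \int[mu]_x g x + \int[sg]_x g x - \int[tau]_x g x.
Proof.
move=> sh img isg itg.
have ing := shifted_integrable sh img isg.
have mg : measurable_fun setT (EFin \o g) by case/integrableP : img.
apply/eqP; rewrite eq_sym subr_eq eq_sym /Rintegral -!fineD//;
  try exact: integrable_fin_num.
rewrite -!integral_measure_add//.
apply/eqP; congr fine; apply: eq_measure_integral => A mA _.
by rewrite [LHS]measure_addE [RHS]measure_addE; exact: sh.
Qed.

(** * Second differences of a quadratic energy *)

Section energy.
Variables (f : T * T -> R) (C : R).
Hypotheses (mf : measurable_fun setT f) (f0 : forall z, 0 <= f z)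
  (fC : forall z, f z <= C).

Definition energy mu nu : R := \int[mu]_x \int[nu]_y f (x, y).

Lemma bounded_integrable mu (g : T -> R) (D : R) : measurable_fun setT g ->
  (forall x, `|g x| <= D) -> mu.-integrable setT (EFin \o g).
Proof.
by move=> mg gD; apply: (@concentrated_integrable _ _ _ _ setT) => //;
  rewrite setCT measure0.
Qed.

Lemma kernel_section_integrable mu x :
  mu.-integrable setT (EFin \o (fun y => f (x, y))).
Proof.
apply: (@bounded_integrable _ _ C); first exact: measurableT_comp.
by move=> y; rewrite ger0_norm.
Qed.

Lemma potential_integrable mu nu :
  mu.-integrable setT (EFin \o (fun x => \int[nu]_y f (x, y))).
Proof.
apply: (@bounded_integrable _ _ (C * fine (nu setT))).
  rewrite /Rintegral; apply: measurableT_comp => //.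
  apply: (@measurable_fun_fubini_tonelli_F _ _ _ _ _ nu (EFin \o f)).
  - exact/measurable_EFinP.
  - by move=> z; rewrite lee_fin.
move=> x; rewrite ger0_norm; last exact: Rintegral_ge0.
apply: (@concentrated_le _ _ _ _ setT) => //.
  by rewrite setCT measure0.
exact: kernel_section_integrable.
Qed.

(** With [h = sg - tau], [nu] and [nu'] are [mu + h] and [mu - h], and this is
    the parallelogram identity for the bilinear form [energy]. *)
Lemma energy_second_difference mu sg tau nu nu' :
  shifted mu sg tau nu -> shifted mu tau sg nu' ->
  energy nu nu + energy nu' nu' = 2 * energy mu mu +
    2 * (energy sg sg + energy tau tau - energy sg tau - energy tau sg).
Proof.
move=> sh sh'; have pot := potential_integrable.
have expand (a s t v : {finite_measure set T -> \bar R}) :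
    shifted a s t v -> energy v v = energy a a + energy a s - energy a t
      + (energy s a + energy s s - energy s t)
      - (energy t a + energy t s - energy t t).
  move=> shv; rewrite /energy.
  have inner (u : {finite_measure set T -> \bar R}) :
      \int[u]_x \int[v]_y f (x, y) = \int[u]_x \int[a]_y f (x, y)
     + \int[u]_x \int[s]_y f (x, y) - \int[u]_x \int[t]_y f (x, y).
    rewrite -RintegralD//; try exact: pot.
    rewrite -[RHS]RintegralB//; try exact: pot; last first.
      exact: (integrableD measurableT (pot u a) (pot u s)).
    apply: eq_Rintegral => x _.
    by apply: shifted_Rintegral => //; exact: kernel_section_integrable.
  by rewrite (shifted_Rintegral shv) ?inner//; exact: pot.
rewrite (expand _ _ _ _ sh) (expand _ _ _ _ sh'); ring.
Qed.

(** By the parallelogram identity it suffices that [energy] be negative on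
    [sg - tau].  Since [sg] and [tau] have the same mass [V], the diagonal
    terms add up to at most [2 m V^2], and the cross terms, which are
    subtracted, to at least [2 M V^2]. *)
Lemma energy_strictly_concave mu sg tau nu nu' (P N : set T) (m M : R) :
  measurable P -> measurable N -> sg (~` P) = 0%E -> tau (~` N) = 0%E ->
  sg setT = tau setT -> (0 < sg setT)%E ->
  shifted mu sg tau nu -> shifted mu tau sg nu' ->
  m < M ->
  (forall x y, P x -> P y -> f (x, y) <= m) ->
  (forall x y, N x -> N y -> f (x, y) <= m) ->
  (forall x y, P x -> N y -> M <= f (x, y) /\ M <= f (y, x)) ->
  energy nu nu + energy nu' nu' < 2 * energy mu mu.
Proof.
move=> mP mN sP tN st s0 sh sh' mM fP fN fPN.
rewrite (energy_second_difference sh sh').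
set V := fine (sg setT).
have V0 : 0 < V by rewrite fine_gt0// s0 -ge0_fin_numE// fin_num_measure.
have tV : fine (tau setT) = V by rewrite /V st.
have int1 := kernel_section_integrable; have int2 := potential_integrable.
have ss : energy sg sg <= m * V * V.
  apply: (concentrated_le mP) => // x Px.
  by apply: (concentrated_le mP) => // y Py; exact: fP.
have tt : energy tau tau <= m * V * V.
  rewrite -{2}tV; apply: (concentrated_le mN) => // x Nx.
  by rewrite -tV; apply: (concentrated_le mN) => // y Ny; exact: fN.
have stl : M * V * V <= energy sg tau.
  apply: (concentrated_ge mP) => // x Px.
  rewrite -tV; apply: (concentrated_ge mN) => // y Ny.
  by have [] := fPN x y Px Ny.
have tsl : M * V * V <= energy tau sg.
  rewrite -{2}tV; apply: (concentrated_ge mN) => // x Nx.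
  by apply: (concentrated_ge mP) => // y Py; have [] := fPN y x Py Nx.
have : m * V * V < M * V * V by rewrite !ltr_pM2r.
lra.
Qed.

End energy.
End exchange.

(** * Existence of perturbed probabilities *)

Section shifted_existence.
Context dsp (T : measurableType dsp) (R : realType).

Section density_measure.
Variables (leb : {measure set T -> \bar R}) (g : T -> R).
Hypotheses (mg : measurable_fun setT g) (g0 : forall x, 0 <= g x)
  (g1 : (\int[leb]_x (g x)%:E = 1)%E).

Definition density_measure (A : set T) : \bar R :=
  (\int[leb]_(x in A) (g x)%:E)%E.

Let nu0 : density_measure set0 = 0%E.
Proof. exact: integral_set0. Qed.

Let nu_ge0 A : (0 <= density_measure A)%E.
Proof. by apply: integral_ge0 => x _; rewrite lee_fin. Qed.

Let nu_sigma_additive : semi_sigma_additive density_measure.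
Proof.
apply: semi_sigma_additive_nng_induced; first exact/measurable_EFinP.
by move=> x; rewrite lee_fin.
Qed.

Lemma exists_probability_density : exists nu : probability T R,
  forall A, nu A = (\int[leb]_(x in A) (g x)%:E)%E.
Proof.
pose m := isMeasure.Build _ _ _ density_measure nu0 nu_ge0 nu_sigma_additive.
pose M : {measure set T -> \bar R} := HB.pack density_measure m.
pose pr := Measure_isProbability.Build _ _ _ M g1.
pose nu : probability T R := HB.pack density_measure m pr.
by exists nu.
Qed.

End density_measure.

(** The perturbed measure has density [f + t 1_P - t 1_N], which is nonnegative
    because [f] is at least [t] on [N], and total mass one because [sg] and
    [tau] have equal masses. *)
Lemma exists_shifted (leb : {measure set T -> \bar R}) (mu : probability T R)
    (f : T -> R) (sg tau : {finite_measure set T -> \bar R})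
    (P N : set T) (t : R) :
  measurable P -> measurable N -> 0 <= t ->
  measurable_fun setT f -> (forall x, 0 <= f x) ->
  (forall A, measurable A -> mu A = \int[leb]_(x in A) (f x)%:E)%E ->
  (forall A, measurable A -> sg A = t%:E * leb (A `&` P))%E ->
  (forall A, measurable A -> tau A = t%:E * leb (A `&` N))%E ->
  sg setT = tau setT ->
  (forall x, N x -> t <= f x) ->
  exists nu : probability T R, shifted mu sg tau nu.
Proof.
move=> mP mN t0 mf f0 muE sgE tauE st tf.
pose g x := f x + t * \1_P x - t * \1_N x.
have mg : measurable_fun setT g.
  apply: measurable_funB; [apply: measurable_funD => //|];
    apply: measurable_funM => //; exact: measurable_indic.
have g0 x : 0 <= g x.
  rewrite /g subr_ge0 [\1_N x]indicE; have [xN|_] := boolP (x \in N).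
    rewrite mulr1 (le_trans (tf x _))//; first exact/set_mem.
    by rewrite lerDl mulr_ge0.
  by rewrite mulr0 addr_ge0// mulr_ge0.
have intI (B A : set T) : measurable B -> measurable A ->
    (\int[leb]_(x in A) (t * \1_B x)%:E = t%:E * leb (A `&` B))%E.
  move=> mB mA; under eq_integral do rewrite EFinM.
  rewrite ge0_integralZl//; first by rewrite integral_indic// setIC.
  by apply/measurable_EFinP/measurable_funTS; exact: measurable_indic.
have key A : measurable A ->
    (\int[leb]_(x in A) (g x)%:E + tau A = mu A + sg A)%E.
  move=> mA; rewrite muE// sgE// tauE// -!intI//.
  rewrite -!ge0_integralD//;
    try (by move=> x _; rewrite lee_fin// mulr_ge0);
    try (by apply/measurable_EFinP/measurable_funTS => //;
      apply: measurable_funM => //; exact: measurable_indic).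
  by apply: eq_integral => x _; rewrite -!EFinD; congr EFin; rewrite /g; ring.
have g1 : (\int[leb]_x (g x)%:E = 1)%E.
  have := key _ measurableT; rewrite probability_setT st.
  move=> /(congr1 (fun z => z - tau setT))%E.
  by rewrite !addeK// fin_num_measure.
have [nu nuE] := exists_probability_density mg g0 g1.
by exists nu => A mA; rewrite [X in (X + _)%E]nuE; exact: key.
Qed.

End shifted_existence.

(** * Concavity of the variance loss *)

Section variance.
Context (R : realType) (d : nat).
Notation point := (d.-tuple R).
Implicit Types m sg tau : {finite_measure set point -> \bar R}.

(** Coordinatewise form of a finite second moment, which also applies to
    measures that are not probabilities. *)
Definition square_integrable m := forall b : 'I_d,
  m.-integrable setT (EFin \o (fun x : point => tnth x b ^+ 2)).

Lemma measurable_sqr_tnth (b : 'I_d) :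
  measurable_fun setT (fun x : point => tnth x b ^+ 2).
Proof. by apply: measurable_funX; exact: measurable_tnth. Qed.

Lemma euclidean_norm_sqr (v : 'rV[R]_d) :
  euclidean_norm v ^+ 2 = \sum_i v 0 i ^+ 2.
Proof. by rewrite sqr_sqrtr// sumr_ge0// => i _; exact: sqr_ge0. Qed.

Lemma finite_second_momentP (mu : probability point R) :
  finite_second_moment mu <-> square_integrable mu.
Proof.
have sumE (x : point) :
    euclidean_norm (tuple_rV x) ^+ 2 = \sum_b tnth x b ^+ 2.
  by rewrite euclidean_norm_sqr; apply: eq_bigr => b _; rewrite mxE.
have msum : measurable_fun setT (fun x : point => \sum_b tnth x b ^+ 2).
  by apply: measurable_sum => b; exact: measurable_sqr_tnth.
rewrite /finite_second_moment; under eq_integral do rewrite sumE.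
split=> [h b|h].
  apply: (@le_integrable _ _ _ mu _ measurableT _
    (EFin \o (fun x : point => \sum_b tnth x b ^+ 2))).
  - by apply/measurable_EFinP; exact: measurable_sqr_tnth.
  - move=> x _ /=; rewrite lee_fin !ger0_norm ?sqr_ge0 ?sumr_ge0//.
    + by rewrite (bigD1 b)//= lerDl sumr_ge0// => i _; exact: sqr_ge0.
    + by move=> i _; exact: sqr_ge0.
  - apply/integrableP; split; first by apply/measurable_EFinP.
    rewrite (eq_integral (fun x : point => (\sum_b tnth x b ^+ 2)%:E))// => x _.
    by rewrite /= ger0_norm// sumr_ge0// => i _; exact: sqr_ge0.
have /integrableP[_] : mu.-integrable setT
    (fun x => \sum_b (tnth x b ^+ 2)%:E)%E.
  by apply: integrable_sum => // b _; exact: h.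
apply: le_lt_trans; rewrite le_eqVlt; apply/orP; left; apply/eqP.
apply: eq_integral => x _; rewrite sumEFin abse_EFin ger0_norm// sumr_ge0//.
by move=> i _; exact: sqr_ge0.
Qed.

Lemma tnth_integrable m b : square_integrable m ->
  m.-integrable setT (EFin \o (fun x : point => tnth x b)).
Proof.
move=> h.
apply: (@le_integrable _ _ _ m _ measurableT _
  (EFin \o (fun x : point => 1 + tnth x b ^+ 2))).
- by apply/measurable_EFinP; exact: measurable_tnth.
- move=> x _ /=; rewrite lee_fin [leRHS]ger0_norm ?addr_ge0 ?sqr_ge0//.
  by rewrite ler_norml; apply/andP; split; nra.
- have i1 : m.-integrable setT (EFin \o cst (1 : R)).
    exact: finite_measure_integrable_cst.
  exact: (integrableD measurableT i1 (h b)).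
Qed.

Lemma Rintegral_sum m (I : Type) (r : seq I) (h : I -> point -> R) :
  (forall i, m.-integrable setT (EFin \o h i)) ->
  \int[m]_x (\sum_(i <- r) h i x) = \sum_(i <- r) \int[m]_x h i x.
Proof.
move=> ih; elim: r => [|i r IHr].
  under eq_Rintegral do rewrite big_nil.
  by rewrite Rintegral_cst// mul0r big_nil.
under eq_Rintegral do rewrite big_cons.
rewrite RintegralD// ?IHr ?big_cons//.
rewrite (_ : EFin \o _ = (fun x => \sum_(j <- r) (h j x)%:E)%E).
  by apply: integrable_sum => // j _; exact: ih.
by apply/funext => x /=; rewrite sumEFin.
Qed.

(** For a diagonal [W] the loss is the [W]-weighted sum of the variances of the
    coordinates. *)
Lemma variance_lossE (W : 'M[R]_d) (mu : probability point R) :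
  is_diag_mx W -> square_integrable mu ->
  variance_loss W mu = \sum_b W b b *
    (\int[mu]_x tnth x b ^+ 2 - (\int[mu]_x tnth x b) ^+ 2).
Proof.
move=> /diag_mxP[D ->] h; rewrite /variance_loss.
pose M b := \int[mu]_x tnth x b.
have meanE b : mean mu 0 b = M b by rewrite mxE unlock.
have I1 b := tnth_integrable b h.
have Ic (r : R) : mu.-integrable setT (EFin \o cst r).
  exact: finite_measure_integrable_cst.
have I1c b : mu.-integrable setT
    (EFin \o (fun x : point => 2 * M b * tnth x b)).
  exact: (integrableZl measurableT (2 * M b) (I1 b)).
have I2 b : mu.-integrable setT
    (EFin \o (fun x : point => tnth x b ^+ 2 - 2 * M b * tnth x b)).
  exact: (integrableB measurableT (h b) (I1c b)).
have I3 b : mu.-integrable setT (EFin \o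
    (fun x : point => tnth x b ^+ 2 - 2 * M b * tnth x b + M b ^+ 2)).
  exact: (integrableD measurableT (I2 b) (Ic _)).
transitivity (\int[mu]_x \sum_b (D 0 b *
    (tnth x b ^+ 2 - 2 * M b * tnth x b + M b ^+ 2))).
  apply: eq_Rintegral => x _; rewrite mul_mx_diag mxE.
  apply: eq_bigr => b _; rewrite -meanE; move: (mean mu) => v.
  by rewrite !mxE; ring.
rewrite Rintegral_sum; last first.
  by move=> b; exact: (integrableZl measurableT (D 0 b) (I3 b)).
apply: eq_bigr => b _; rewrite RintegralZl// mxE eqxx mulr1n; congr (_ * _).
rewrite RintegralD//; last exact: Ic.
rewrite RintegralB//; last exact: h.
rewrite RintegralZl//; last exact: I1.
rewrite Rintegral_cst//.
rewrite [X in fine X](probability_setT mu) -/(M b)/=; ring.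
Qed.

(** Second moments are affine in the measure and cancel in the second
    difference, which therefore equals
    [-2 \sum_b W b b * (\int x_b dsg - \int x_b dtau)^2].  Equality of the
    means in the directions [b != a] removes the weights of unknown sign. *)
Lemma variance_strictly_concave (W : 'M[R]_d) (a : 'I_d)
    (mu nu nu' : probability point R) sg tau :
  is_diag_mx W -> 0 < W a a ->
  square_integrable mu -> square_integrable sg -> square_integrable tau ->
  shifted mu sg tau nu -> shifted mu tau sg nu' ->
  (forall b, b != a -> \int[sg]_x tnth x b = \int[tau]_x tnth x b) ->
  \int[sg]_x tnth x a != \int[tau]_x tnth x a ->
  variance_loss W nu + variance_loss W nu' < 2 * variance_loss W mu.
Proof.
move=> Wd Wa hm hs ht sh sh' eqb neqa.
have hn : square_integrable nu by move=> b; exact: (shifted_integrable sh).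
have hn' : square_integrable nu' by move=> b; exact: (shifted_integrable sh').
rewrite !variance_lossE// mulr_sumr -big_split/= -subr_gt0 -sumrB.
have I1 b m : square_integrable m -> m.-integrable setT
  (EFin \o (fun x : point => tnth x b)) by exact: tnth_integrable.
have E b : 2 * (W b b * (\int[mu]_x tnth x b ^+ 2 - (\int[mu]_x tnth x b) ^+ 2))
  - (W b b * (\int[nu]_x tnth x b ^+ 2 - (\int[nu]_x tnth x b) ^+ 2) +
     W b b * (\int[nu']_x tnth x b ^+ 2 - (\int[nu']_x tnth x b) ^+ 2)) =
  2 * W b b * (\int[sg]_x tnth x b - \int[tau]_x tnth x b) ^+ 2.
  rewrite (shifted_Rintegral sh (I1 b _ hm) (I1 b _ hs) (I1 b _ ht)).
  rewrite (shifted_Rintegral sh' (I1 b _ hm) (I1 b _ ht) (I1 b _ hs)).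
  rewrite (shifted_Rintegral sh (hm b) (hs b) (ht b)).
  rewrite (shifted_Rintegral sh' (hm b) (ht b) (hs b)); ring.
rewrite (eq_bigr _ (fun b _ => E b)) (bigD1 a)//= big1 ?addr0; last first.
  by move=> b ba; rewrite eqb// subrr expr0n mulr0.
apply: mulr_gt0; first exact: mulr_gt0.
by rewrite exprn_even_gt0//= subr_eq0.
Qed.

End variance.

(** * Exchanging mass between two components *)

Section optimality.
Context (R : realType) (d K : nat).
Notation point := (d.-tuple R).
Implicit Types sg tau : {finite_measure set point -> \bar R}.

Lemma sum_two_changed (V : nmodType) (i j : 'I_K) (F G : 'I_K -> V) :
  i != j -> (forall k, k != i -> k != j -> F k = G k) ->
  F i + F j = G i + G j -> \sum_k F k = \sum_k G k.
Proof.
move=> ij FG E; rewrite (bigD1 i)//= [RHS](bigD1 i)//=.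
rewrite (bigD1 j) 1?eq_sym//= [in RHS](bigD1 j) 1?eq_sym//= !addrA E.
by congr (_ + _); apply: eq_bigr => k /andP[ki kj]; exact: FG.
Qed.

Definition replace_two (i j : 'I_K) (mu : 'I_K -> probability point R)
    (nui nuj : probability point R) (k : 'I_K) : probability point R :=
  if k == i then nui else if k == j then nuj else mu k.

(** The weights are balanced by [p i * sgi = p j * sgj] and
    [p i * taui = p j * tauj]: what component [i] gains, component [j] loses. *)
Lemma feasible_exchange (pi : probability point R) (p : 'I_K -> R)
    (mu : 'I_K -> probability point R) (i j : 'I_K)
    (sgi taui sgj tauj : {finite_measure set point -> \bar R})
    (nui nuj : probability point R) :
  feasible pi p mu -> i != j ->
  shifted (mu i) sgi taui nui -> shifted (mu j) tauj sgj nuj ->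
  square_integrable sgi -> square_integrable tauj ->
  (forall A, measurable A -> (p i)%:E * sgi A = (p j)%:E * sgj A)%E ->
  (forall A, measurable A -> (p i)%:E * taui A = (p j)%:E * tauj A)%E ->
  feasible pi p (replace_two i j mu nui nuj).
Proof.
move=> [musq mupi] ij shi shj isg jtau sgE tauE.
have musq' k : square_integrable (mu k) by apply/finite_second_momentP.
split=> [k|A mA].
  rewrite /replace_two; case: ifP => [_|_].
    apply/finite_second_momentP => b.
    exact: (shifted_integrable shi (musq' i b) (isg b)).
  case: ifP => [_|_]; last exact: musq.
  apply/finite_second_momentP => b.
  exact: (shifted_integrable shj (musq' j b) (jtau b)).
rewrite -mupi//; apply: (@sum_two_changed _ i j) => // [k ki kj|].
  by rewrite /replace_two (negbTE ki) (negbTE kj).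
rewrite /replace_two eqxx eq_sym (negbTE ij) eqxx.
have := shi A mA; have := shj A mA; have := sgE A mA; have := tauE A mA.
have fin (m : {finite_measure set point -> \bar R}) : m A = (fine (m A))%:E.
  by rewrite fineK//; exact: fin_num_measure.
rewrite (fin nui) (fin nuj) (fin (mu i)) (fin (mu j)) (fin sgi) (fin sgj).
rewrite (fin taui) (fin tauj) -!EFinM -!EFinD.
move=> [e1] [e2] [e3] [e4].
transitivity (p i * fine (nui A) + p j * fine (nuj A))%:E.
  by rewrite EFinD !EFinM -!fin.
transitivity (p i * fine (mu i A) + p j * fine (mu j A))%:E; last first.
  by rewrite EFinD !EFinM -!fin.
congr EFin.
have -> : fine (nui A) = fine (mu i A) + fine (sgi A) - fine (taui A) by lra.
have -> : fine (nuj A) = fine (mu j A) + fine (tauj A) - fine (sgj A) by lra.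
rewrite !mulrDr !mulrN e1 e2; ring.
Qed.

(** The two exchanges in opposite directions are both feasible, so neither
    lowers the objective; but by strict concavity the sum of their objectives
    is less than twice the optimal value. *)
Lemma optimal_no_concave_exchange (L : probability point R -> R)
    (pi : probability point R) (p : 'I_K -> R)
    (mu : 'I_K -> probability point R) (i j : 'I_K)
    (sgi taui sgj tauj : {finite_measure set point -> \bar R})
    (nui nui' nuj nuj' : probability point R) :
  optimal_decomposition L pi p mu -> i != j -> 0 < p i -> 0 < p j ->
  (forall A, measurable A -> (p i)%:E * sgi A = (p j)%:E * sgj A)%E ->
  (forall A, measurable A -> (p i)%:E * taui A = (p j)%:E * tauj A)%E ->
  square_integrable sgi -> square_integrable taui ->
  square_integrable sgj -> square_integrable tauj ->
  shifted (mu i) sgi taui nui -> shifted (mu i) taui sgi nui' ->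
  shifted (mu j) sgj tauj nuj -> shifted (mu j) tauj sgj nuj' ->
  ~ (L nui + L nui' < 2 * L (mu i) /\ L nuj + L nuj' < 2 * L (mu j)).
Proof.
move=> [mufeas muopt] ij pi0 pj0 sgE tauE isg itau jsg jtau si si' sj sj'.
move=> [ci cj].
have f1 : feasible pi p (replace_two i j mu nui nuj').
  exact: (feasible_exchange mufeas ij si sj').
have f2 : feasible pi p (replace_two i j mu nui' nuj).
  exact: (feasible_exchange mufeas ij si' sj).
have := lerD (muopt _ f1) (muopt _ f2); apply/negP; rewrite -ltNge.
rewrite /objective -!big_split/=.
rewrite (bigD1 i)//= [ltRHS](bigD1 i)//= (bigD1 j) 1?eq_sym//=.
rewrite [in ltRHS](bigD1 j) 1?eq_sym//=.
rewrite /replace_two eqxx [j == i]eq_sym (negbTE ij) eqxx.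
rewrite [X in _ + (_ + X) < _](eq_bigr
  (fun k => p k * L (mu k) + p k * L (mu k)));
  last by move=> k /andP[/negbTE -> /negbTE ->].
rewrite !addrA ltrD2r; nra.
Qed.

End optimality.

(** * Two translated cubes near a point *)

Lemma box_offsets (R : realType) (l : R) : 0 < l ->
  - (2 * l) <= - (2 * l) <= l /\ - (2 * l) <= l <= l.
Proof. by move=> l0; split; apply/andP; split; lra. Qed.

Section boxes.
Context (R : realType) (d : nat).
Notation point := (d.-tuple R).
Variables (x0 : point) (a : 'I_d) (l : R).
Hypothesis l0 : 0 < l.

(** A cube of side [l] with corner [x0], translated by [s] in direction [a].
    The two translates used below are [s = l] and [s = - (2 * l)]: they lie on
    either side of [x0], at distance [2 * l] from each other. *)
Definition box_side (s : R) (b : 'I_d) : set R :=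
  let y := tnth x0 b + (if b == a then s else 0) in `[y, y + l]%classic.

Definition box (s : R) : set point :=
  [set x | forall b, box_side s b (tnth x b)].

Lemma measurable_box_side s b : measurable (box_side s b).
Proof. exact: measurable_itv. Qed.

Lemma measurable_box s : measurable (box s).
Proof.
rewrite (_ : box s = \bigcap_(b in [set: 'I_d])
    ((fun x : point => tnth x b) @^-1` box_side s b)).
  apply: fin_bigcap_measurable => // b _.
  rewrite -[X in measurable X]setTI.
  by apply: (measurable_tnth b) => //; exact: measurable_box_side.
by apply/seteqP; split=> x /= Bx b; [move=> _; exact: Bx|exact: Bx].
Qed.

Lemma box_side_length s b : lebesgue_measure (box_side s b) = l%:E.
Proof.
rewrite lebesgue_measure_itv/= lte_fin ltrDl l0 -EFinB; congr EFin; ring.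
Qed.

Lemma box_volume s : lebesgue_tuple R d (box s) = (l ^+ d)%:E.
Proof.
rewrite lebesgue_tuple_box; last by move=> b; exact: measurable_box_side.
under eq_bigr do rewrite box_side_length.
by rewrite prodEFin prodr_const card_ord.
Qed.

Lemma box_lty s : (lebesgue_tuple R d (box s) < +oo)%E.
Proof. by rewrite box_volume ltry. Qed.

(** Translating in direction [a] does not affect the distribution of the other
    coordinates: slicing a box by a condition on [x_b] gives a product of sides
    in which only the side in direction [a] has moved. *)
Lemma box_cylinder s s' b (A : set R) : b != a -> measurable A ->
  lebesgue_tuple R d (box s `&` [set x | A (tnth x b)]) =
  lebesgue_tuple R d (box s' `&` [set x | A (tnth x b)]).
Proof.
move=> ba mA.
pose side u (e : 'I_d) := box_side u e `&` (if e == b then A else setT).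
have mside u e : measurable (side u e).
  by apply: measurableI; [exact: measurable_box_side|case: ifP].
have E u : box u `&` [set x | A (tnth x b)] =
    [set x | forall e, side u e (tnth x e)].
  apply/seteqP; split=> x /=.
    by move=> [Bx Ax] e; split; [exact: Bx|case: eqP => // ->].
  move=> Bx; split=> [e|]; first by have [] := Bx e.
  by have [_] := Bx b; rewrite eqxx.
rewrite !E !lebesgue_tuple_box//; apply: eq_bigr => e _.
rewrite /side; have [->|eb] := eqVneq e b.
  by rewrite /box_side (negbTE ba).
by rewrite !setIT !box_side_length.
Qed.

Lemma box_coordinate_norm s b x : - (2 * l) <= s <= l -> box s x ->
  `|tnth x b| <= `|tnth x0 b| + 2 * l.
Proof.
move=> /andP[s1 s2] /(_ b); rewrite /box_side/= in_itv/=.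
have := ler_norm (tnth x0 b); have := ler_norm (- tnth x0 b); rewrite normrN.
by case: ifP => _ h1 h2 /andP[h3 h4]; rewrite ler_norml; apply/andP; split; lra.
Qed.

Lemma box_sub_ball (delta : R) s x : 2 * d%:R * l <= delta ->
  - (2 * l) <= s <= l -> box s x ->
  euclidean_norm (tuple_rV x0 - tuple_rV x) <= delta.
Proof.
move=> ld /andP[s1 s2] Bx.
have d1 : 1 <= d%:R :> R by rewrite ler1n; case: (d) a => // -[].
have delta0 : 0 <= delta by apply: le_trans ld; rewrite !mulr_ge0// ltW.
rewrite -[leRHS]ger0_norm// -sqrtr_sqr ler_sqrt ?sqr_ge0//.
apply: (@le_trans _ _ (\sum_(b < d) (2 * l) ^+ 2)).
  apply: ler_sum => b _; rewrite !mxE.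
  have := Bx b; rewrite /box_side/= in_itv/=.
  by case: ifP => _ /andP[h1 h2]; nra.
rewrite sumr_const card_ord -mulr_natl.
apply: (@le_trans _ _ ((2 * d%:R * l) ^+ 2)); first by nra.
by rewrite ler_pXn2r// nnegrE !mulr_ge0// ltW.
Qed.

Definition box_measure (t : {nonneg R}) s :
    {finite_measure set point -> \bar R} :=
  mscale t (mfrestr (measurable_box s) (box_lty s)).

Lemma box_measureE t s A :
  box_measure t s A = (t%:num%:E * lebesgue_tuple R d (A `&` box s))%E.
Proof. by []. Qed.

Lemma box_measureT t s : box_measure t s setT = (t%:num * l ^+ d)%:E.
Proof. by rewrite box_measureE setTI box_volume EFinM. Qed.

Lemma box_measure_concentrated t s : box_measure t s (~` box s) = 0%E.
Proof. by rewrite box_measureE setICl measure0 mule0. Qed.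

Lemma box_measure_tnth_integrable t s b : - (2 * l) <= s <= l ->
  (box_measure t s).-integrable setT (EFin \o (fun x : point => tnth x b)).
Proof.
move=> sl; apply: (concentrated_integrable (measurable_box s)).
- exact: box_measure_concentrated.
- exact: measurable_tnth.
- by move=> x; exact: box_coordinate_norm.
Qed.

Lemma box_measure_square_integrable t s : - (2 * l) <= s <= l ->
  square_integrable (box_measure t s).
Proof.
move=> sl b; apply: (@concentrated_integrable _ _ _ _ _ (measurable_box s)
  _ _ ((`|tnth x0 b| + 2 * l) ^+ 2)).
- exact: box_measure_concentrated.
- exact: measurable_sqr_tnth.
- move=> x Bx; rewrite normrX lerXn2r ?nnegrE//;
    last exact: box_coordinate_norm Bx.
  by rewrite addr_ge0// mulr_ge0// ltW.
Qed.

(** The two integrals are those of the identity against the images of the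
    measures under [x |-> x_b], and these images coincide by
    [box_cylinder]. *)
Lemma box_measure_mean_off t s s' b : b != a ->
  - (2 * l) <= s <= l -> - (2 * l) <= s' <= l ->
  \int[box_measure t s]_x tnth x b = \int[box_measure t s']_x tnth x b.
Proof.
move=> ba sl sl'.
have mb : measurable_fun setT (fun x : point => tnth x b).
  exact: measurable_tnth.
have push u : - (2 * l) <= u <= l -> \int[box_measure t u]_x tnth x b =
    fine (\int[pushforward (box_measure t u)
      (fun x : point => tnth x b)]_y y%:E)%E.
  move=> ul; rewrite integral_pushforward//.
  exact: box_measure_tnth_integrable.
rewrite !push//; congr fine; apply: eq_measure_integral => A mA _.
rewrite /pushforward [LHS]box_measureE [RHS]box_measureE; congr (_ * _)%E.
by rewrite ![(_ @^-1` _) `&` _]setIC; exact: box_cylinder.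
Qed.

Lemma box_measure_mean_on t : 0 < t%:num ->
  \int[box_measure t (- (2 * l))]_x tnth x a < \int[box_measure t l]_x tnth x a.
Proof.
move=> t0; have [h1 h2] := box_offsets l0.
have lo : \int[box_measure t (- (2 * l))]_x tnth x a <=
    (tnth x0 a - l) * (t%:num * l ^+ d).
  rewrite -[t%:num * _]/(fine (t%:num * l ^+ d)%:E).
  rewrite -(box_measureT t (- (2 * l))).
  apply: (concentrated_le (measurable_box (- (2 * l)))) => //.
  - exact: box_measure_concentrated.
  - exact: box_measure_tnth_integrable.
  - by move=> x /(_ a); rewrite /box_side eqxx/= in_itv/= => /andP[_]; lra.
have hi : (tnth x0 a + l) * (t%:num * l ^+ d) <=
    \int[box_measure t l]_x tnth x a.
  rewrite -[t%:num * _]/(fine (t%:num * l ^+ d)%:E) -(box_measureT t l).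
  apply: (concentrated_ge (measurable_box l)) => //.
  - exact: box_measure_concentrated.
  - exact: box_measure_tnth_integrable.
  - by move=> x /(_ a); rewrite /box_side eqxx/= in_itv/= => /andP[].
apply: le_lt_trans lo (lt_le_trans _ hi).
by rewrite ltr_pM2r ?mulr_gt0 ?exprn_gt0//; move: l0; lra.
Qed.

(** The box that loses mass lies in the ball around [x0] where the density
    exceeds [c], which is at least the density [t] that is taken away. *)
Lemma exists_box_shift (mu : probability point R) (f : point -> R)
    (delta c : R) (t : {nonneg R}) s s' :
  is_density mu f -> interior_support f delta c x0 -> t%:num <= c ->
  2 * d%:R * l <= delta -> - (2 * l) <= s' <= l ->
  exists nu : probability point R,
    shifted mu (box_measure t s) (box_measure t s') nu.
Proof.
move=> [mf f0 fE] fx0 tc ld sl.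
apply: (@exists_shifted _ _ _ (lebesgue_tuple R d) mu f _ _
  (box s) (box s') t%:num);
  rewrite ?box_measureT//; try exact: measurable_box.
move=> x Bx; apply: (le_trans tc); apply/ltW/fx0.
exact: (box_sub_ball ld sl Bx).
Qed.

End boxes.

(** * Concavity of the Elo loss *)

Section elo.
Context (R : realType).
Notation point := (1.-tuple R).

(** The integrand of the Elo loss, extended by zero outside of positive skills.
    The power [`^ (-1)] agrees with the inverse on positive numbers; writing it
    so makes measurability a case of that of real powers. *)
Definition elo_kernel (z : point * point) : R :=
  \1_skills z.1 * \1_skills z.2 *
  (head 0 z.1 * (head 0 z.1 + head 0 z.2) `^ (-1) - 2^-1) ^+ 2.

Lemma measurable_head : measurable_fun setT (fun x : point => head 0 x).
Proof.
rewrite (_ : (fun x : point => head 0 x) = (fun x => tnth x ord0)).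
  exact: measurable_tnth.
by apply/funext => x; rewrite (tnth_nth 0)/= nth0.
Qed.

Lemma measurable_skills : measurable (skills : set point).
Proof.
rewrite (_ : skills = setT `&` (fun x : point => head 0 x) @^-1` `]0, +oo[).
  by apply: measurable_head => //; exact: measurable_itv.
by apply/seteqP; split=> x /=; rewrite /skills/= in_itv/= andbT//; case.
Qed.

Lemma measurable_elo_kernel : measurable_fun setT elo_kernel.
Proof.
have m1 : measurable_fun setT (fun z : point * point => head 0 z.1).
  exact: (measurableT_comp measurable_head measurable_fst).
have m2 : measurable_fun setT (fun z : point * point => head 0 z.2).
  exact: (measurableT_comp measurable_head measurable_snd).
have mi := @measurable_indic _ _ R setT _ measurable_skills.
apply: measurable_funM; first apply: measurable_funM.
- exact: (measurableT_comp mi measurable_fst).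
- exact: (measurableT_comp mi measurable_snd).
apply: measurable_funX; apply: measurable_funB => //.
apply: measurable_funM => //.
exact: (measurableT_comp (@measurable_powR R (-1)) (measurable_funD m1 m2)).
Qed.

Lemma elo_kernelE x y : skills x -> skills y ->
  elo_kernel (x, y) = (head 0 x / (head 0 x + head 0 y) - 2^-1) ^+ 2.
Proof.
move=> hx hy; rewrite /elo_kernel/= !indicE !mem_set// !mul1r powR_inv1//.
by rewrite addr_ge0// ltW.
Qed.

Lemma elo_kernel_out x y : ~ (skills x /\ skills y) -> elo_kernel (x, y) = 0.
Proof.
move=> h; rewrite /elo_kernel/= !indicE.
have [/set_mem hx|] := boolP (x \in skills); last by rewrite !mul0r.
have [/set_mem hy|] := boolP (y \in skills); last by rewrite mulr0 mul0r.
by exfalso; apply: h.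
Qed.

Lemma elo_kernel_ge0 z : 0 <= elo_kernel z.
Proof.
rewrite /elo_kernel !indicE.
by apply: mulr_ge0; [exact: mulr_ge0|exact: sqr_ge0].
Qed.

Lemma elo_score_offset (u v : R) : 0 < u -> 0 < v ->
  u / (u + v) - 2^-1 = (u - v) / (2 * (u + v)).
Proof. by move=> u0 v0; field; lra. Qed.

Lemma elo_kernel_le1 z : elo_kernel z <= 1.
Proof.
case: z => x y; have [[hx hy]|h] := pselect (skills x /\ skills y); last first.
  by rewrite elo_kernel_out.
rewrite elo_kernelE// elo_score_offset//.
have {hx} hx : 0 < head 0 x by [].
have {hy} hy : 0 < head 0 y by [].
have D : 0 < 2 * (head 0 x + head 0 y) by lra.
rewrite -[leLHS]real_normK ?num_real// expr_le1//.
by rewrite ler_norml ler_pdivlMr// ler_pdivrMr//; apply/andP; split; lra.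
Qed.

Lemma elo_lossE (mu : probability point R) :
  elo_loss mu = energy elo_kernel mu mu.
Proof.
rewrite /elo_loss /energy Rintegral_mkcond; apply: eq_Rintegral => x _.
rewrite patchE; case: ifPn => [/set_mem hx|hx].
  rewrite Rintegral_mkcond; apply: eq_Rintegral => y _.
  rewrite patchE; case: ifPn => [/set_mem hy|hy]; first by rewrite elo_kernelE.
  by rewrite elo_kernel_out// => -[_ /mem_set]; rewrite (negbTE hy).
under eq_Rintegral => y _.
  rewrite elo_kernel_out; last by move=> -[/mem_set]; rewrite (negbTE hx).
  over.
by rewrite Rintegral_cst// mul0r.
Qed.

Lemma head_box (x0 : point) (l s : R) x : box x0 ord0 l s x ->
  head 0 x0 + s <= head 0 x <= head 0 x0 + s + l.
Proof.
move=> /(_ ord0); rewrite /box_side eqxx/= in_itv/=.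
by rewrite !(tnth_nth 0)/= !nth0.
Qed.

Lemma elo_kernel_near (x y : point) (h l : R) : 0 < h -> 0 <= l ->
  skills x -> skills y -> 3 * h <= 2 * (head 0 x + head 0 y) ->
  `|head 0 x - head 0 y| <= l ->
  elo_kernel (x, y) <= (l / (3 * h)) ^+ 2.
Proof.
move=> h0 l0 hx hy xy dl.
have h30 : 0 < 3 * h by rewrite mulr_gt0.
have D : 0 < 2 * (head 0 x + head 0 y) by exact: lt_le_trans xy.
rewrite elo_kernelE// elo_score_offset// -[leLHS]real_normK ?num_real//.
rewrite lerXn2r ?nnegrE ?divr_ge0 ?(ltW h30)//.
rewrite normrM normfV (ger0_norm (ltW D)) ler_pdivrMr// mulrAC ler_pdivlMr//.
by apply: ler_pM => //; exact: ltW.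
Qed.

Lemma elo_kernel_far (x y : point) (h l : R) : 0 < h -> 0 <= l ->
  skills x -> skills y -> 2 * (head 0 x + head 0 y) <= 5 * h ->
  2 * l <= `|head 0 x - head 0 y| ->
  (2 * l / (5 * h)) ^+ 2 <= elo_kernel (x, y).
Proof.
move=> h0 l0 hx hy xy dl.
have h50 : 0 < 5 * h by rewrite mulr_gt0.
have D : 0 < 2 * (head 0 x + head 0 y) by rewrite mulr_gt0// addr_gt0.
have l20 : 0 <= 2 * l by rewrite mulr_ge0.
rewrite elo_kernelE// elo_score_offset// -[leRHS]real_normK ?num_real//.
rewrite lerXn2r ?nnegrE ?divr_ge0 ?(ltW h50)//.
rewrite normrM normfV (ger0_norm (ltW D)) ler_pdivlMr// mulrAC ler_pdivrMr//.
by apply: ler_pM => //; exact: ltW.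
Qed.

Lemma elo_kernel_same_box (x0 : point) (l s : R) x y :
  0 < l -> 8 * l <= head 0 x0 ->
  - (2 * l) <= s -> box x0 ord0 l s x -> box x0 ord0 l s y ->
  elo_kernel (x, y) <= (l / (3 * head 0 x0)) ^+ 2.
Proof.
move=> l0 lx sl /head_box/andP[x1 x2] /head_box/andP[y1 y2].
apply: elo_kernel_near; rewrite /skills/=; try lra.
by rewrite ler_norml; apply/andP; split; lra.
Qed.

Lemma elo_kernel_distinct_boxes (x0 : point) (l : R) x y :
  0 < l -> 8 * l <= head 0 x0 ->
  box x0 ord0 l l x -> box x0 ord0 l (- (2 * l)) y ->
  (2 * l / (5 * head 0 x0)) ^+ 2 <= elo_kernel (x, y) /\
  (2 * l / (5 * head 0 x0)) ^+ 2 <= elo_kernel (y, x).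
Proof.
move=> l0 lx /head_box/andP[x1 x2] /head_box/andP[y1 y2].
have xy : 2 * l <= `|head 0 x - head 0 y|.
  by apply: le_trans (ler_norm _); lra.
have yx : 2 * l <= `|head 0 y - head 0 x| by rewrite distrC.
by split; apply: elo_kernel_far; rewrite /skills/=; try lra.
Qed.

(** When [8 * l <= x0], both boxes lie in [[3/4 x0, 5/4 x0]].  There the kernel
    is at most [(l / (3 x0))^2] for two points of the same box and at least
    [(2 l / (5 x0))^2] for points of different boxes. *)
Lemma elo_loss_strictly_concave (x0 : point) (l : R) (l0 : 0 < l)
    (t : {nonneg R}) (mu nu nu' : probability point R) :
  8 * l <= head 0 x0 -> 0 < t%:num ->
  shifted mu (box_measure x0 ord0 l0 t l)
             (box_measure x0 ord0 l0 t (- (2 * l))) nu ->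
  shifted mu (box_measure x0 ord0 l0 t (- (2 * l)))
             (box_measure x0 ord0 l0 t l) nu' ->
  elo_loss nu + elo_loss nu' < 2 * elo_loss mu.
Proof.
move=> lx t0 sh sh'; rewrite !elo_lossE.
have [_ /andP[l2 _]] := box_offsets l0.
have h0 : 0 < head 0 x0 by apply: lt_le_trans lx; rewrite mulr_gt0.
apply: (@energy_strictly_concave _ _ _ elo_kernel 1 _ _ _ mu
    (box_measure x0 ord0 l0 t l) (box_measure x0 ord0 l0 t (- (2 * l))) nu nu'
    (box x0 ord0 l l) (box x0 ord0 l (- (2 * l)))
    ((l / (3 * head 0 x0)) ^+ 2) ((2 * l / (5 * head 0 x0)) ^+ 2)).
- exact: measurable_elo_kernel.
- exact: elo_kernel_ge0.
- exact: elo_kernel_le1.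
- exact: measurable_box.
- exact: measurable_box.
- exact: box_measure_concentrated.
- exact: box_measure_concentrated.
- by rewrite !box_measureT.
- by rewrite box_measureT lte_fin mulr_gt0// exprn_gt0.
- exact: sh.
- exact: sh'.
- have -> : l / (3 * head 0 x0) = (5 / 6) * (2 * l / (5 * head 0 x0)).
    by field; rewrite gt_eqF.
  have q0 : 0 < 2 * l / (5 * head 0 x0) by rewrite divr_gt0// mulr_gt0.
  by rewrite exprMn gtr_pMl ?exprn_gt0//; lra.
- by move=> x y; exact: elo_kernel_same_box.
- by move=> x y; exact: elo_kernel_same_box.
- by move=> x y; exact: elo_kernel_distinct_boxes.
Qed.

End elo.

(** * Disjointness of the interior supports *)

Section conclusion.
Context (R : realType) (d : nat).
Notation point := (d.-tuple R).

(** The exchanged masses are [c * p j] for component [i] and [c * p i] for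
    component [j]: they are inversely proportional to the weights, and at most
    the lower bound [c] on the densities since [p k <= 1]. *)
Lemma no_common_interior_point (K : nat) (pi : probability point R)
    (p : 'I_K -> R) (hp : forall k, 0 < p k) (hp1 : \sum_(k < K) p k = 1)
    (L : probability point R -> R) (mu : 'I_K -> probability point R)
    (f : 'I_K -> point -> R) (delta c : R) (i j : 'I_K)
    (x0 : point) (a : 'I_d) (l : R) (l0 : 0 < l) :
  (forall k, is_density (mu k) (f k)) -> optimal_decomposition L pi p mu ->
  0 < c -> i != j -> 2 * d%:R * l <= delta ->
  (forall (t : {nonneg R}) (m nu nu' : probability point R), 0 < t%:num ->
    square_integrable m ->
    shifted m (box_measure x0 a l0 t l)
              (box_measure x0 a l0 t (- (2 * l))) nu ->
    shifted m (box_measure x0 a l0 t (- (2 * l)))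
              (box_measure x0 a l0 t l) nu' ->
    L nu + L nu' < 2 * L m) ->
  interior_support (f i) delta c x0 -> interior_support (f j) delta c x0 ->
  False.
Proof.
move=> hf hopt c0 ij ld hconc fi fj.
have p1 k : p k <= 1.
  by rewrite -hp1 (bigD1 k)//= lerDl sumr_ge0// => k' _; exact/ltW.
have cp0 k : 0 <= c * p k by rewrite mulr_ge0// ltW.
pose ti := NngNum (cp0 j); pose tj := NngNum (cp0 i).
have cp k : c * p k <= c by rewrite ger_pMr.
have [r1 r2] := box_offsets l0.
have [nui ni] :=
  exists_box_shift a l0 l (hf i) fi (cp j : ti%:num <= c) ld r1.
have [nui' ni'] := exists_box_shift a l0 (- (2 * l)) (hf i) fi
  (cp j : ti%:num <= c) ld r2.
have [nuj nj] :=
  exists_box_shift a l0 l (hf j) fj (cp i : tj%:num <= c) ld r1.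
have [nuj' nj'] := exists_box_shift a l0 (- (2 * l)) (hf j) fj
  (cp i : tj%:num <= c) ld r2.
have musq k : square_integrable (mu k).
  by apply/finite_second_momentP; have [[]] := hopt.
have bal s A : measurable A -> ((p i)%:E * box_measure x0 a l0 ti s A =
    (p j)%:E * box_measure x0 a l0 tj s A)%E.
  move=> _; rewrite !box_measureE !muleA -!EFinM; congr (_%:E * _)%E.
  by rewrite /=; ring.
apply: (optimal_no_concave_exchange hopt ij (hp i) (hp j)
  (bal l) (bal (- (2 * l))) _ _ _ _ ni ni' nj nj');
  try exact: box_measure_square_integrable.
by split; [apply: (hconc _ _ _ _ _ _ ni ni')|apply: (hconc _ _ _ _ _ _ nj nj')];
  rewrite //= mulr_gt0.
Qed.

End conclusion.

Lemma variance_box_strictly_concave (R : realType) (d : nat) (W : 'M[R]_d)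
    (x0 : d.-tuple R) (a : 'I_d) (l : R) (l0 : 0 < l) (t : {nonneg R})
    (mu nu nu' : probability (d.-tuple R) R) :
  is_diag_mx W -> 0 < W a a -> 0 < t%:num -> square_integrable mu ->
  shifted mu (box_measure x0 a l0 t l) (box_measure x0 a l0 t (- (2 * l))) nu ->
  shifted mu (box_measure x0 a l0 t (- (2 * l)))
             (box_measure x0 a l0 t l) nu' ->
  variance_loss W nu + variance_loss W nu' < 2 * variance_loss W mu.
Proof.
move=> Wd Wa t0 hm sh sh'.
have [r1 r2] := box_offsets l0.
apply: (variance_strictly_concave Wd Wa hm _ _ sh sh').
- exact: box_measure_square_integrable.
- exact: box_measure_square_integrable.
- by move=> b ba; exact: box_measure_mean_off.
- by rewrite gt_eqF// box_measure_mean_on.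
Qed.

Lemma feasible_null (R : realType) (d K : nat) (pi : probability (d.-tuple R) R)
    (p : 'I_K -> R) (mu : 'I_K -> probability (d.-tuple R) R) A k :
  (forall k, 0 < p k) -> feasible pi p mu -> measurable A -> pi A = 0%E ->
  mu k A = 0%E.
Proof.
move=> hp [_ mupi] mA; rewrite -mupi// (bigD1 k)//= => /eqP.
rewrite padde_eq0 ?mule_ge0 ?lee_fin ?(ltW (hp k))//; last first.
  by rewrite sume_ge0// => k' _; rewrite mule_ge0// lee_fin ltW.
by rewrite mule_eq0 eqe gt_eqF//= => /andP[/eqP].
Qed.

(** Otherwise the box to the left of [x0] consists of nonpositive skills, and
    the density exceeds [c] on it, so that it would have positive mass. *)
Lemma interior_support_skills (R : realType) (mu : probability (1.-tuple R) R)
    (f : 1.-tuple R -> R) (delta c : R) (x0 : 1.-tuple R) :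
  is_density mu f -> mu (~` skills) = 0%E -> 0 < delta -> 0 < c ->
  interior_support f delta c x0 -> 0 < head 0 x0.
Proof.
move=> [mf f0 fE] mu0 delta0 c0 fx0; rewrite ltNge; apply/negP => x0_le0.
pose l := delta / 2.
have l0 : 0 < l by rewrite divr_gt0.
have [r1 _] := box_offsets l0.
pose B := box x0 ord0 l (- (2 * l)).
have mB : measurable B by exact: measurable_box.
have BS : B `<=` ~` skills.
  move=> x /head_box /andP[_ xl]; rewrite /skills/= => xpos.
  by clear mu0 fE; lra.
have : (c%:E * lebesgue_tuple R 1 B <= 0)%E.
  rewrite -mu0; apply: (@le_trans _ _ (mu B)); last first.
    apply: le_measure; rewrite ?inE//.
    exact: measurableC (@measurable_skills R).
  rewrite fE// -(integral_cst _ mB); apply: ge0_le_integral => //.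
  - by move=> x _; rewrite lee_fin ltW.
  - by apply/measurable_EFinP; exact: measurable_funTS.
  - move=> x Bx; rewrite lee_fin; apply/ltW/fx0.
    apply: (box_sub_ball l0 _ r1 Bx).
    by rewrite mulr1 /l mulrC divfK.
by rewrite box_volume// expr1 -EFinM lee_fin leNgt mulr_gt0.
Qed.

Theorem corollary1 (R : realType) (d : nat) (hd : (0 < d)%N)
  (pi : probability (d.-tuple R) R) (hpi : finite_second_moment pi)
  (K : nat) (hK : (0 < K)%N)
  (p : 'I_K -> R) (hp : forall k, 0 < p k) (hp1 : \sum_(k < K) p k = 1)
  (L : probability (d.-tuple R) R -> R)
  (hL : [/\ d = 1%N, pi skills = 1%E & L = @elo_loss R d] \/
        (exists W : 'M[R]_d,
          [/\ is_diag_mx W, forall i, W i i != 0, exists i, 0 < W i i &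
              L = variance_loss W]))
  (mu : 'I_K -> probability (d.-tuple R) R) (f : 'I_K -> d.-tuple R -> R)
  (hf : forall k, is_density (mu k) (f k))
  (hmu : optimal_decomposition L pi p mu)
  (delta c : R) (hdelta : 0 < delta) (hc : 0 < c)
  (i j : 'I_K) (hij : i != j) :
  interior_support (f i) delta c `&` interior_support (f j) delta c = set0.
Proof.
apply/seteqP; split=> // x0 [fi fj].
case: hL => [[d1 piS LE]|[W [Wd _ [a Wa] LE]]].
  subst d L.
  have mS : measurable (~` skills : set (1.-tuple R)).
    exact: measurableC (@measurable_skills R).
  have piN : pi (~` skills) = 0%E.
    by rewrite probability_setC ?piS ?subee//; exact: measurable_skills.
  have x00 : 0 < head 0 x0.
    apply: interior_support_skills (hf i) _ hdelta hc fi.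
    exact: feasible_null hp hmu.1 mS piN.
  pose l := Num.min (delta / 2) (head 0 x0 / 8).
  have l0 : 0 < l by rewrite lt_min !divr_gt0.
  apply: (no_common_interior_point hp hp1 (a := ord0) (l0 := l0)
    hf hmu hc hij _ _ fi fj).
    by rewrite mulr1 mulrC -ler_pdivlMr// ge_min lexx.
  move=> t m nu nu' t0 _; apply: elo_loss_strictly_concave => //.
  by rewrite mulrC -ler_pdivlMr// ge_min lexx orbT.
subst L.
have d0 : 0 < 2 * d%:R :> R by rewrite mulr_gt0// ltr0n.
pose l := delta / (2 * d%:R).
have l0 : 0 < l by rewrite divr_gt0.
apply: (no_common_interior_point hp hp1 (a := a) (l0 := l0)
    hf hmu hc hij _ _ fi fj).
  by rewrite mulrC divfK// gt_eqF.
by move=> t m nu nu'; exact: variance_box_strictly_concave.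
Qed.
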